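(* Let $Q=T[H_1,\dots,H_t]$ be a strong semicomplete composition. Then there is an arc (in at least one direction) between every 3-king of $Q$ and every non-king of $Q$; moreover, for every non-king $u$ of $Q$ there exists a 3-king $v$ of $Q$ such that $d_Q(u,v)>3$ and $v$ dominates $u$ (i.e. $vu\in A(Q)$).
   Context: All digraphs are finite, without loops or parallel arcs; paths are directed; $d_Q(x,y)$ is the length of a shortest directed $x$–$y$ path (infinite if none). Let $T$ be a digraph with vertices $u_1,\dots,u_t$ ($t\ge 2$) and $H_1,\dots,H_t$ digraphs, $H_i$ having vertices $u_{i,j}$, $1\le j\le n_i$. The composition $Q=T[H_1,\dots,H_t]$ has vertex set $\{u_{i,j}\}$ and arc set $\bigcup_i A(H_i)\cup\{u_{i,j}u_{p,q}: u_iu_p\in A(T)\}$ (all $j,q$). It is a semicomplete composition if $T$ is semicomplete (at least one arc between every two distinct vertices). A digraph is strong if every vertex can reach every other vertex. A 3-king is a vertex from which every other vertex can be reached by a directed path of length at most 3; a non-king is a vertex which is not a 3-king. *)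

(* Defs.v *)
From mathcomp Require Import all_boot.

Set Implicit Arguments.
Unset Strict Implicit.
Unset Printing Implicit Defensive.

Record digraph := Digraph {
  vertex :> finType;
  darc : rel vertex;
  darc_irr : irreflexive darc
}.

Definition dipath (D : digraph) (x y : D) (p : seq D) : bool :=
  [&& path (@darc D) x p, last x p == y & uniq (x :: p)].

Definition has_dipath (D : digraph) (x y : D) (k : nat) : bool :=
  [exists p : k.-tuple D, dipath x y p].

(* [None] is the infinite distance. The search range is exhaustive: a directed
   path has no repeated vertex, so its length is smaller than [#|D|]; see
   [distP] and [distN]. *)
Definition dist (D : digraph) (x y : D) : option nat :=
  let k := find (has_dipath x y) (iota 0 #|D|) in
  if k < #|D| then Some k else None.

Definition dist_gt (d : option nat) (k : nat) : bool :=
  if d is Some l then k < l else true.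

Definition semicomplete (D : digraph) : Prop :=
  forall x y : D, x != y -> darc x y || darc y x.

Definition strong (D : digraph) : Prop :=
  forall x y : D, exists p : seq D, dipath x y p.

Definition king (k : nat) (D : digraph) (x : D) : Prop :=
  forall y : D, y != x -> exists2 p : seq D, dipath x y p & size p <= k.

(* [tagged_as x y] is the second component of [y], transported to [H (tag x)];
   it is only meaningful under the guard [tag x == tag y]. *)
Definition comp_arc (T : digraph) (H : T -> digraph) (x y : {i : T & H i}) : bool :=
  (tag x == tag y) && darc (tagged x) (tagged_as x y)
  || darc (tag x) (tag y).

Lemma comp_arc_irr (T : digraph) (H : T -> digraph) :
  irreflexive (@comp_arc T H).
Proof.
by case=> i x; rewrite /comp_arc tagged_asE !darc_irr andbF.
Qed.

Definition composition (T : digraph) (H : T -> digraph) : digraph :=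
  Digraph (@comp_arc_irr T H).

Lemma has_dipathP (D : digraph) (x y : D) (k : nat) :
  reflect (exists2 p : seq D, dipath x y p & size p = k) (has_dipath x y k).
Proof.
apply: (iffP existsP) => [[p xyp]|[p xyp <-]]; first by exists p; rewrite ?size_tuple.
by exists (in_tuple p).
Qed.

Lemma has_dipath_lt (D : digraph) (x y : D) (k : nat) :
  has_dipath x y k -> k < #|D|.
Proof.
case/has_dipathP=> p /and3P[_ _ /card_uniqP Up] <-.
by have := max_card (mem (x :: p)); rewrite Up.
Qed.

Lemma distP (D : digraph) (x y : D) (k : nat) :
  dist x y = Some k <->
  has_dipath x y k /\ (forall l, has_dipath x y l -> k <= l).
Proof.
rewrite /dist; set a := has_dipath x y; set s := iota 0 #|D|.
have szs : size s = #|D| by rewrite size_iota.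
split=> [|[ak kmin]].
  case: ifP => // lt_s [<-]; split.
    have /(nth_find 0) : has a s by rewrite has_find szs.
    by rewrite nth_iota.
  move=> l al; rewrite leqNgt; apply/negP => /(before_find 0).
  by rewrite nth_iota ?(has_dipath_lt al) // al.
have lt_k := has_dipath_lt ak.
have has_s : has a s by apply/hasP; exists k; rewrite // mem_iota.
have lt_s : find a s < #|D| by rewrite -szs -has_find.
rewrite lt_s; congr Some; apply/eqP; rewrite eqn_leq; apply/andP; split.
  rewrite leqNgt; apply/negP => /(before_find 0).
  by rewrite nth_iota // ak.
by apply: kmin; have := nth_find 0 has_s; rewrite nth_iota.
Qed.

Lemma distN (D : digraph) (x y : D) :
  dist x y = None <-> (forall p : seq D, ~~ dipath x y p).
Proof.
split=> [|no_p].
  rewrite /dist; case: ifP => // ge_s _ p; apply/negP => xyp.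
  have ap : has_dipath x y (size p) by apply/has_dipathP; exists p.
  suff: has (has_dipath x y) (iota 0 #|D|) by rewrite has_find size_iota ge_s.
  by apply/hasP; exists (size p); rewrite // mem_iota (has_dipath_lt ap).
case E: (dist x y) => [k|] //.
by case/distP: E => /has_dipathP[p xyp _]; case/negP: (no_p p).
Qed.

(* Main.v *)
Require Import Defs.
From mathcomp Require Import all_boot.

Set Implicit Arguments.
Unset Strict Implicit.
Unset Printing Implicit Defensive.

(** Between different parts, distances in [Q] are distances in [T]; inside one
part they are at most 3, because a strong semicomplete [T] has a closed walk of
length 2 or 3 through each vertex.  Hence being a 3-king only depends on the
part, a king and a non-king lie in different, hence adjacent, parts, and it
remains to treat [T].  If [i] is not a 3-king of [T], let [N] be the set of
vertices at distance more than 3 from [i].  Every vertex of [N] dominates every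
vertex at distance at most 2 from [i], so a vertex of maximum out-degree in
[T[N]], which is a 2-king of [T[N]], is a 3-king of [T]. *)

(** Bounded reachability by walks instead of paths: being boolean and free of [uniq], it
    concatenates and supports case analysis directly. [reachP] recovers [dipath]. *)
Fixpoint reach (D : digraph) (k : nat) (x y : D) : bool :=
  (x == y) ||
  (if k is k'.+1 then [exists z, darc x z && reach k' z y] else false).

Lemma reach_refl (D : digraph) (k : nat) (x : D) : reach k x x.
Proof. by case: k => [|k] /=; rewrite eqxx. Qed.

Lemma reach_arc (D : digraph) (k : nat) (x z y : D) :
  darc x z -> reach k z y -> reach k.+1 x y.
Proof.
by move=> xz zy; apply/orP; right; apply/existsP; exists z; rewrite xz.
Qed.

Lemma reach_le (D : digraph) (k l : nat) (x y : D) :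
  k <= l -> reach k x y -> reach l x y.
Proof.
elim: k l x => [|k IHk] [|l] x //= le_kl; first by rewrite orbF => ->.
case/orP=> [-> //|/existsP[z /andP[xz zy]]].
by apply/orP; right; apply/existsP; exists z; rewrite xz IHk.
Qed.

Lemma reach_trans (D : digraph) (k l : nat) (x y z : D) :
  reach k x y -> reach l y z -> reach (k + l) x z.
Proof.
elim: k x => [|k IHk] x; first by rewrite /= orbF => /eqP->.
case/orP=> [/eqP-> yz|/existsP[w /andP[xw wy]] yz].
  exact: reach_le (leq_addl _ _) yz.
exact: reach_arc xw (IHk _ wy yz).
Qed.

(** [reach] peels off the first arc; this peels off the last one. *)
Lemma reach_last (D : digraph) (k : nat) (x y : D) :
  reach k.+1 x y -> reach k x y \/ exists2 z, reach k x z & darc z y.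
Proof.
elim: k x => [|k IHk] x.
  case/orP=> [/eqP->|]; first by left; apply: reach_refl.
  case/existsP=> z /andP[xz /=]; rewrite orbF => /eqP<-.
  by right; exists x; rewrite ?eqxx.
case/orP=> [/eqP->|/existsP[w /andP[xw /IHk[wy|[z wz zy]]]]].
- by left; apply: reach_refl.
- by left; apply: reach_arc xw wy.
by right; exists z => //; apply: reach_arc xw wz.
Qed.

Lemma reachP (D : digraph) (k : nat) (x y : D) :
  reflect (exists2 p : seq D, dipath x y p & size p <= k) (reach k x y).
Proof.
apply: (iffP idP) => [xy|[p /and3P[xp /eqP<- _]]].
  (* Prepending an arc may break [uniq], so the induction builds a walk, which is shortened only
     once at the end. *)
  suff [p xp [<- le_pk]] : exists2 p, path (@darc D) x p & last x p = y /\ size p <= k.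
    case: (shortenP xp) => q xq Uq sub_qp.
    exists q; first by rewrite /dipath xq eqxx.
    by apply: leq_trans (uniq_leq_size _ sub_qp) le_pk; case/andP: Uq.
  elim: k x xy => [|k IHk] x /=; first by rewrite orbF => /eqP->; exists [::].
  case/orP=> [/eqP->|/existsP[z /andP[xz /IHk[p zp [yE le_pk]]]]].
    by exists [::].
  by exists (z :: p); rewrite //= xz.
elim: p k x xp => [|z p IHp] [|k] x //=; rewrite ?eqxx //.
by case/andP=> xz zp le_pk; apply: reach_arc xz (IHp _ _ zp le_pk).
Qed.

Lemma kingP (D : digraph) (k : nat) (x : D) :
  king k x <-> forall y, reach k x y.
Proof.
split=> [xK y|xK y _]; last exact/reachP.
by have [->|neq_yx] := eqVneq y x; [apply: reach_refl | apply/reachP/xK].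
Qed.

Lemma dist_gt_reach (D : digraph) (k : nat) (x y : D) :
  ~~ reach k x y -> dist_gt (dist x y) k.
Proof.
case E: (dist x y) => [l|] //=; rewrite ltnNge; apply: contra => le_lk.
case/distP: E => /has_dipathP[p xyp szp] _.
by apply/reachP; exists p; rewrite // szp.
Qed.

Lemma strong_exit (D : digraph) (S : pred D) (x y : D) :
  strong D -> S x -> ~~ S y -> exists z w, [/\ S z, ~~ S w & darc z w].
Proof.
move=> D_strong Sx; have [p /and3P[xp /eqP<- _]] := D_strong x y.
elim: p x Sx xp => [|w p IHp] x Sx /=; first by rewrite Sx.
case/andP=> xw wp; have [Sw|nSw] := boolP (S w); first exact: IHp wp.
by exists x, w.
Qed.

(** Landau's argument: if [j] did not reach [w] in two steps, [w] would dominate [j] and all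
    out-neighbours of [j] in [N], so its out-degree in [N] would be larger. *)
Lemma two_king_in (T : digraph) (N : {set T}) (x : T) :
  semicomplete T -> x \in N ->
  exists2 j, j \in N & forall w, w \in N -> reach 2 j w.
Proof.
move=> T_semi xN; pose out j := [set w in N | darc j w].
have [j jN jmax] := @arg_maxnP T x (fun j => j \in N) (fun j => #|out j|) xN.
exists j => // w wN; apply/negPn/negP => nr_jw.
have neq_jw : j != w by apply: contraNneq nr_jw => ->; apply: reach_refl.
have n_jw : ~~ darc j w.
  by apply: contra nr_jw => jw; apply: reach_arc jw (reach_refl _ _).
have wj : darc w j by have := T_semi _ _ neq_jw; rewrite (negPf n_jw).
have sub : out j \proper out w.
  apply/properP; split; last by exists j; rewrite !inE jN ?darc_irr.
  apply/subsetP=> a; rewrite !inE => /andP[aN ja]; rewrite aN /=.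
  have neq_aw : a != w by apply: contraNneq n_jw => <-.
  have := T_semi _ _ neq_aw; case/orP=> // aw; case/negP: nr_jw.
  exact: reach_arc ja (reach_arc aw (reach_refl 0 _)).
by have := jmax w wN; rewrite /= /geq /= leqNgt proper_card.
Qed.

Lemma semicomplete_non_king (T : digraph) (i x : T) :
  semicomplete T -> ~~ reach 3 i x ->
  exists2 j, ~~ reach 3 i j & forall w, reach 3 j w.
Proof.
move=> T_semi ix; pose N := [set j | ~~ reach 3 i j].
have [|j] := @two_king_in T N x T_semi; first by rewrite inE.
rewrite inE => ij j2N; exists j => // w.
(* An arc from [b] to [j] would put [j] within distance 3 of [i]. *)
have near b : reach 2 i b -> darc j b.
  move=> ib; have neq_jb : j != b.
    by apply: contraNneq ij => ->; apply: reach_le ib.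
  have /orP[//|bj] := T_semi _ _ neq_jb; case/negP: ij.
  exact: (reach_trans ib (reach_arc bj (reach_refl 0 _))).
have [iw|niw] := boolP (reach 3 i w); last first.
  by apply: (@reach_le _ 2) => //; apply: j2N; rewrite inE.
(* Either [j] dominates [w] itself, or it dominates the predecessor [b] of [w] on a short walk from
   [i]. *)
have [iw2|[b ib bw]] := reach_last iw.
  exact: reach_arc (near w iw2) (reach_refl 2 _).
exact: reach_arc (near b ib) (reach_arc bw (reach_refl 1 _)).
Qed.

(** An arc inside a part projects to no move at all, so walks can only get shorter in [T]. *)
Lemma reach_tag (T : digraph) (H : T -> digraph) (k : nat) (x y : composition H) :
  reach k x y -> reach k (tag x) (tag y).
Proof.
elim: k x => [|k IHk] x; first by rewrite /= !orbF => /eqP->.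
case/orP=> [/eqP->|/existsP[z /andP[xz /IHk zy]]]; first exact: reach_refl.
case/orP: xz => [/andP[/eqP xzE _]|xz]; last exact: reach_arc xz zy.
by rewrite xzE; apply: reach_le (leqnSn k) zy.
Qed.

(** Intermediate vertices are chosen arbitrarily in their parts; as soon as the walk enters the part
    of [y], it can enter at [y] itself. *)
Lemma reach_lift (T : digraph) (H : T -> digraph) (k : nat) (x y : composition H) :
  (forall i : T, 0 < #|H i|) -> tag x != tag y ->
  reach k (tag x) (tag y) -> reach k x y.
Proof.
move=> H_gt0; elim: k x => [|k IHk] x neq_xy.
  by rewrite /= orbF (negPf neq_xy).
case/orP=> [/eqP xy|/existsP[a /andP[xa ay]]]; first by rewrite xy eqxx in neq_xy.
have [aE|neq_ay] := eqVneq a (tag y).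
  by apply: (@reach_arc _ _ _ y); rewrite ?reach_refl //= /comp_arc -aE xa orbT.
have /card_gt0P[h _] := H_gt0 a.
pose z : composition H := Tagged (fun i => vertex (H i)) h.
have xz : darc x z by rewrite /= /comp_arc xa orbT.
exact: reach_arc xz (IHk z neq_ay ay).
Qed.

Lemma reach_same_tag (T : digraph) (H : T -> digraph) (x y : composition H) :
  2 <= #|T| -> (forall i : T, 0 < #|H i|) -> semicomplete T ->
  strong (composition H) -> tag x = tag y -> reach 3 x y.
Proof.
move=> T_ge2 H_gt0 T_semi Q_strong xyE.
have arcQ (z w : composition H) : darc (tag z) (tag w) -> darc z w.
  by move=> zw; rewrite /= /comp_arc zw orbT.
have [z neq_zx] : exists z : composition H, tag z != tag x.
  have /card_gt0P[i] : 0 < #|predC1 (tag x)|.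
    by have := cardC1 (tag x); rewrite -ltnS => ->; rewrite prednK // ltnW.
  have /card_gt0P[h _] := H_gt0 i; rewrite inE => neq_ix.
  by exists (Tagged (fun i => vertex (H i)) h).
(* An arc leaving the part of [x], on a path to [z], joins distinct parts and so comes from an arc
   of [T]. *)
have [w0 xw0] : exists w : composition H, darc (tag x) (tag w).
  have [||v [w [/= /eqP<- neq_wx]]] :=
    @strong_exit _ (fun w : composition H => tag w == tag x) x z Q_strong.
  - exact: eqxx.
  - exact: neq_zx.
  by rewrite /comp_arc eq_sym (negPf neq_wx) /=; exists w.
(* A path back to [x] leaves the out-neighbourhood of the part of [x] by an arc
[v -> w]; the end [w] is in that part or, by semicompleteness, dominates it. *)
have [||v [w [xv nxw vw]]] :=
  @strong_exit _ (fun w : composition H => darc (tag x) (tag w)) w0 x Q_strong.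
- exact: xw0.
- by rewrite darc_irr.
have neq_vw : tag v != tag w by apply: contraNneq nxw => <-.
have {}vw : darc (tag v) (tag w) by move: vw; rewrite /= /comp_arc (negPf neq_vw).
apply: (reach_arc (arcQ x v xv)).
(* Arcs between parts ignore the vertex chosen, so a walk back to the part of [x] can end at [y]:
   through [v] alone, or through [v] and [w]. *)
have [wxE|neq_wx] := eqVneq (tag w) (tag x).
  by apply: reach_arc (reach_refl 1 y); apply: arcQ; rewrite -xyE -wxE.
apply: (reach_arc (arcQ v w vw)); apply: reach_arc (reach_refl 0 y); apply: arcQ.
by have := T_semi _ _ neq_wx; rewrite (negPf nxw) orbF xyE.
Qed.

Lemma reach_composition (T : digraph) (H : T -> digraph) (x y : composition H) :
  2 <= #|T| -> (forall i : T, 0 < #|H i|) -> semicomplete T ->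
  strong (composition H) -> reach 3 x y = reach 3 (tag x) (tag y).
Proof.
move=> T_ge2 H_gt0 T_semi Q_strong; apply/idP/idP; first exact: reach_tag.
have [xyE _|] := eqVneq (tag x) (tag y); last exact: reach_lift.
exact: reach_same_tag.
Qed.

Lemma king_composition (T : digraph) (H : T -> digraph) (x : composition H) :
  2 <= #|T| -> (forall i : T, 0 < #|H i|) -> semicomplete T ->
  strong (composition H) -> king 3 x <-> king 3 (tag x).
Proof.
move=> T_ge2 H_gt0 T_semi Q_strong.
have rE y := @reach_composition T H x y T_ge2 H_gt0 T_semi Q_strong.
split=> /kingP xK; apply/kingP; last by move=> y; rewrite rE.
move=> i; have /card_gt0P[h _] := H_gt0 i.
by have := xK (Tagged (fun i => vertex (H i)) h); rewrite rE.
Qed.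

Theorem theorem2p9 (T : digraph) (H : T -> digraph)
  (T_ge2 : 2 <= #|T|)
  (H_gt0 : forall i : T, 0 < #|H i|)
  (T_semicomplete : semicomplete T)
  (Q_strong : strong (composition H)) :
  (forall v u : composition H, king 3 v -> ~ king 3 u -> darc v u || darc u v) /\
  (forall u : composition H, ~ king 3 u ->
     exists v : composition H,
       [/\ king 3 v, dist_gt (dist u v) 3 & darc v u]).
Proof.
have kE (x : composition H) := king_composition x T_ge2 H_gt0 T_semicomplete Q_strong.
split=> [v u /kE vK nuK|u nuK].
  have neq_vu : tag v != tag u.
    by apply/eqP => vuE; apply/nuK/kE; rewrite -vuE.
  by have := T_semicomplete _ _ neq_vu; rewrite /= /comp_arc => /orP[] ->; rewrite !orbT.
have [x nux] : exists x, ~~ reach 3 (tag u) x.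
  apply/existsP; rewrite -negb_forall; apply/negP => /forallP uK.
  exact/nuK/kE/kingP.
have [j nuj jK] := semicomplete_non_king T_semicomplete nux.
have /card_gt0P[h _] := H_gt0 j.
pose v : composition H := Tagged (fun i => vertex (H i)) h.
exists v; split.
- exact/kE/kingP.
- by apply: dist_gt_reach; apply: contra nuj => /reach_tag.
have neq_uj : tag u != j by apply: contraNneq nuj => ->; apply: reach_refl.
(* The arc from [tag u] to [j] is excluded, since [j] is out of reach of [tag u] in three steps. *)
have /orP[uj|ju] := T_semicomplete _ _ neq_uj.
  by case/negP: nuj; apply: reach_arc uj (reach_refl 2 _).
by rewrite /= /comp_arc ju orbT.
Qed.
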